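(* Let $\mathcal{M}$ be a dependence epistemic model, $s\in S$, let $\mathcal{P}$ be either $\mathcal{P}_g$ or $\mathcal{P}_l$, and let $W\subseteq\mathbb{V}$ be nonempty finite. Put $\Sigma(s,W)=\{W'\in\mathcal{P}(s)\mid W'\subseteq W\}$. The following are equivalent: (a) $W$ is generative from $\mathcal{P}(s)$; (b) $\bigcup\Sigma(s,W)=W$, and for every nonempty $Z\subsetneq W$ there is $W'\in\Sigma(s,W)$ with $W'\cap Z\neq\emptyset$ and $W'\cap(W\setminus Z)\neq\emptyset$; (c) $\bigcup\Sigma(s,W)=W$, and for every nonempty $\Gamma\subsetneq\Sigma(s,W)$, $(\bigcup\Gamma)\cap(\bigcup(\Sigma(s,W)\setminus\Gamma))\neq\emptyset$; (d) $\bigcup\Sigma(s,W)=W$, and, defining $\mathcal{R}W_1'W_2'$ iff $W_1'\cap W_2'\neq\emptyset$ for $W_1',W_2'\in\Sigma(s,W)$, any two $W_1',W_2'\in\Sigma(s,W)$ are connected by a finite chain of $\mathcal{R}$-related elements of $\Sigma(s,W)$.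
   Context: Fix a countable set $\mathbb{P}$ of propositions and a countable set $\mathbb{V}$ of variables. A dependence epistemic model is $\mathcal{M}=\langle S,T,V,U,\sim_i,\approx\rangle$ where $S$ is a set of worlds, $T:S\times\mathbb{P}\to\{0,1\}$, $V\supseteq\mathbb{V}$ is a countable set of variables, $U:S\times V\to\mathbb{N}$, and $\sim_i,\approx$ are equivalence relations on $S$. For $X\subseteq V$, $X_u=X_v$ means $U(u,x)=U(v,x)$ for all $x\in X$. For $u,v\in S$, $\Delta(u,v)=\{x\in\mathbb{V}\mid U(u,x)\neq U(v,x)\}$ if $(V\setminus\mathbb{V})_u=(V\setminus\mathbb{V})_v$, and $\Delta(u,v)=\emptyset$ otherwise. $W$ is an evidence of $\langle X,Y\rangle$ iff $W\cap X\neq\emptyset$, $W\cap Y\neq\emptyset$, $W\subseteq X\cup Y$. $\mathcal{P}_g(s)=\{\Delta(u,v)\mid u,v\in S,\ u\approx v\approx s,\ \Delta(u,v)\text{ nonempty finite}\}$ and $\mathcal{P}_l(s)=\{\Delta(t,s)\mid t\in S,\ t\approx s,\ \Delta(t,s)\text{ nonempty finite}\}$. A nonempty finite $W\subseteq\mathbb{V}$ is generative from $\mathcal{P}(s)$ iff for all finite $X,Y\subseteq\mathbb{V}$ such that $W$ is an evidence of $\langle X,Y\rangle$, there is $W'\in\mathcal{P}(s)$ that is also an evidence of $\langle X,Y\rangle$. *)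

(* Defs.v *)
From mathcomp Require Import all_boot.
From mathcomp Require Import boolp classical_sets functions cardinality.

Set Implicit Arguments.
Unset Strict Implicit.
Unset Printing Implicit Defensive.

Local Open Scope classical_set_scope.

(* [VV] is the fixed set of variables of the language; it and the variable set
   [vars] of a model live in an ambient type [Var].  "Countable" means at most
   countable.  The values of [value] outside [vars] are never used. *)
Record depModel (Atom : countType) (Agent Var : Type) (VV : set Var) := DepModel {
  world :> Type;
  truth : world -> Atom -> bool;
  vars : set Var;
  vars_countable : countable vars;
  VV_sub_vars : VV `<=` vars;
  value : world -> Var -> nat;
  indist : Agent -> world -> world -> Prop;
  indist_equiv : forall i, RelationClasses.Equivalence (indist i);
  approx : world -> world -> Prop;
  approx_equiv : RelationClasses.Equivalence approx
}.

Section Model.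
Context (Atom : countType) (Agent Var : Type) (VV : set Var).
Variable M : depModel Atom Agent VV.

Definition agree (X : set Var) (u v : M) : Prop :=
  forall x, X x -> value u x = value v x.

Definition Delta (u v : M) : set Var :=
  if `[< agree (vars M `\` VV) u v >]
  then [set x | VV x /\ value u x <> value v x]
  else set0.

Definition Pg (s : M) : set (set Var) :=
  [set W | exists u v : M,
     [/\ approx u v, approx v s, W = Delta u v, W !=set0 & finite_set W]].

Definition Pl (s : M) : set (set Var) :=
  [set W | exists t : M,
     [/\ approx t s, W = Delta t s, W !=set0 & finite_set W]].

End Model.

Section Generative.
Context (Var : Type).
Implicit Types (W X Y : set Var) (F : set (set Var)).

Definition evidence W X Y : Prop :=
  [/\ W `&` X !=set0, W `&` Y !=set0 & W `<=` X `|` Y].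

Definition generative (VV : set Var) F W : Prop :=
  forall X Y, X `<=` VV -> finite_set X -> Y `<=` VV -> finite_set Y ->
    evidence W X Y -> exists2 W', F W' & evidence W' X Y.

Definition Sigma F W : set (set Var) := [set W' | F W' /\ W' `<=` W].

Definition overlap W1 W2 : Prop := W1 `&` W2 !=set0.

(* The chain is c 0, ..., c n; the values of c beyond n are irrelevant. *)
Definition chain_connected F W1 W2 : Prop :=
  exists (n : nat) (c : nat -> set Var),
    [/\ c 0 = W1, c n = W2,
        forall k, k <= n -> F (c k)
      & forall k, k < n -> overlap (c k) (c k.+1)].

End Generative.

(* Main.v *)
(** All that matters about [P s] is that its members are nonempty.
    Generativity gives (b) by testing the pairs [([set x], W)], for covering,
    and [(Z, W `\` Z)].  A subfamily violating (c) has a union violating (b),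
    and a connected component violating (d) is a subfamily violating (c).
    Finally, a chain inside [W] joining a member that meets [X] to a member that
    meets [Y] passes through one meeting both, since a member missing [Y] lies
    in [X], whence its successor meets [X]. *)
Require Import Defs.
From mathcomp Require Import all_boot.
From mathcomp Require Import boolp classical_sets functions cardinality.

Local Open Scope classical_set_scope.

Lemma Pg_neq0 (Atom : countType) (Agent Var : Type) (VV : set Var)
    (M : depModel Atom Agent VV) (s : M) (W : set Var) :
  Pg s W -> W !=set0.
Proof. by move=> [u [v []]]. Qed.

Lemma Pl_neq0 (Atom : countType) (Agent Var : Type) (VV : set Var)
    (M : depModel Atom Agent VV) (s : M) (W : set Var) :
  Pl s W -> W !=set0.
Proof. by move=> [t []]. Qed.

Section Families.
Context (Var : Type).
Implicit Types (W X Y Z : set Var) (F : set (set Var)).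

Definition splits F W : Prop :=
  forall Z, Z !=set0 -> Z `<` W ->
    exists2 W', F W' & W' `&` Z !=set0 /\ W' `&` (W `\` Z) !=set0.

Definition indecomposable F : Prop :=
  forall Gam : set (set Var), Gam !=set0 -> Gam `<` F ->
    (\bigcup_(W' in Gam) W') `&` (\bigcup_(W' in F `\` Gam) W') !=set0.

Lemma bigcup_Sigma F W :
  W `<=` \bigcup_(W' in Sigma F W) W' -> \bigcup_(W' in Sigma F W) W' = W.
Proof.
by move=> cov; apply/seteqP; split=> // x [W' [_ sub] W'x]; exact: sub.
Qed.

(** Evidence of [([set x], W)] contains [x] and lies in [[set x]]|[W], which is just [W]; it is thus
    a member of [Sigma F W] covering [x]. *)
Lemma generative_covers VV F W : W `<=` VV -> finite_set W ->
  generative VV F W -> \bigcup_(W' in Sigma F W) W' = W.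
Proof.
move=> WV Wfin gen; apply: bigcup_Sigma => x Wx.
have xW : [set x] `<=` W by move=> _ ->.
have ev : evidence W [set x] W.
  by split; [exists x | exists x | move=> y Wy; right].
have [W' FW' [[y [W'y /= yx]] _ sub]] :=
  gen [set x] W (subset_trans xW WV) (finite_set1 x) WV Wfin ev.
by exists W'; [split=> // z /sub [/xW|] | rewrite -yx].
Qed.

(** The two test sets partition [W], so any evidence of the pair stays inside [W] and falls in
    [Sigma F W]. *)
Lemma generative_splits VV F W : W `<=` VV -> finite_set W ->
  generative VV F W -> splits (Sigma F W) W.
Proof.
move=> WV Wfin gen Z [z Zz] [ZW /existsNP [w /not_implyP [Ww nZw]]].
have DW : W `\` Z `<=` W by move=> y [].
have ev : evidence W Z (W `\` Z).
  split; [by exists z; split=> //; exact: ZW | by exists w |].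
  by move=> y Wy; case: (pselect (Z y)) => ?; [left | right].
have [W' FW' [W'Z W'D sub]] :=
  gen Z (W `\` Z) (subset_trans ZW WV) (sub_finite_set ZW Wfin)
    (subset_trans DW WV) (sub_finite_set DW Wfin) ev.
by exists W' => //; split=> // y /sub [/ZW|/DW].
Qed.

Lemma splits_indecomposable F W : (forall W', F W' -> W' !=set0) ->
  \bigcup_(W' in F) W' = W -> splits F W -> indecomposable F.
Proof.
move=> F0 cov split_FW Gam [G GG] [GF /existsNP [H /not_implyP [FH nGH]]].
apply: contrapT => disj.
(* If the two unions are disjoint, no point is shared by a member of [Gam] and a member outside
   it. *)
have apart x A B : Gam A -> A x -> F B -> ~ Gam B -> B x -> False.
  by move=> *; apply: disj; exists x; split; [exists A | exists B].
have [||W' FW' [[x [W'x [A GA Ax]]] [y [W'y [_ nZy]]]]] :=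
    split_FW (\bigcup_(W' in Gam) W').
- by have [x Gx] := F0 _ (GF _ GG); exists x, G.
- split=> [x [A GA Ax]|sub]; first by rewrite -cov; exists A => //; exact: GF.
  (* The union of [Gam] is proper in [W]: it misses every point of [H], and [H] is nonempty. *)
  have [x Hx] := F0 _ FH.
  have [|A GA Ax] := sub x; first by rewrite -cov; exists H.
  exact: apart GA Ax FH nGH Hx.
(* Inside [Gam], the straddling [W'] could not reach [y]; outside, it could not share [x] with
   [A]. *)
- have [GW'|nGW'] := pselect (Gam W'); first by apply: nZy; exists W'.
  exact: apart GA Ax FW' nGW' W'x.
Qed.

Lemma chain_connected_rcons F W1 W2 W3 :
  chain_connected F W1 W2 -> F W3 -> overlap W2 W3 -> chain_connected F W1 W3.
Proof.
move=> [n [c [c0 cn cF c_ov]]] FW3 ov.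
(* The values of [c] after [n] are arbitrary, so they are overwritten by [W3]; the only new link is
   the one at [k = n]. *)
exists n.+1, (fun k => if k <= n then c k else W3); split=> //.
- by rewrite ltnn.
- by move=> k _; case: ifP => // /cF.
- move=> k; rewrite ltnS => kn; rewrite kn; case: ltnP => [|nk]; first exact: c_ov.
  have -> : k = n by apply/eqP; rewrite eqn_leq kn nk.
  by rewrite cn.
Qed.

Lemma indecomposable_connected F W1 W2 :
  indecomposable F -> F W1 -> F W2 -> chain_connected F W1 W2.
Proof.
move=> indec FW1 FW2; apply: contrapT => nconn.
(* The component of [W1] contains [W1] by the chain of length zero and omits [W2] by assumption; a
   member [B] outside it that meets some [A] inside would extend the chain to [A]. *)
have [||x [[A [FA cA] Ax] [B [FB nB] Bx]]] :=
    indec [set A | F A /\ chain_connected F W1 A].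
- by exists W1; split=> //; exists 0, (fun=> W1); split.
- by split=> [A []//|sub]; apply: nconn; case: (sub _ FW2).
- by apply: nB; split=> //; apply: chain_connected_rcons cA FB _; exists x.
Qed.

Lemma chain_evidence F W1 W2 X Y : (forall A, F A -> A `<=` X `|` Y) ->
  chain_connected F W1 W2 -> W1 `&` X !=set0 -> W2 `&` Y !=set0 ->
  exists2 A, F A & evidence A X Y.
Proof.
move=> Fsub [n [c [<- <- cF c_ov]]] c0X cnY; apply: contrapT => none.
(* If no member is evidence, meeting [X] propagates along the chain: a point common to [c k] and its
   successor cannot lie in [Y], so it lies in [X]. Then [c n] meets both sets. *)
have cX k : k <= n -> c k `&` X !=set0.
  elim: k => // k IH kn; have [x [cx cx']] := c_ov _ kn.
  exists x; split=> //.
  have [//|Yx] := Fsub _ (cF _ (ltnW kn)) _ cx.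
  case: none; exists (c k); first exact: cF (ltnW kn).
  by split; [exact: IH (ltnW kn) | exists x | exact/Fsub/cF/ltnW].
by apply: none; exists (c n); [exact: cF | split=> //; [exact: cX | exact/Fsub/cF]].
Qed.

Lemma connected_generative VV F W : \bigcup_(W' in Sigma F W) W' = W ->
  (forall W1 W2, Sigma F W W1 -> Sigma F W W2 ->
     chain_connected (Sigma F W) W1 W2) ->
  generative VV F W.
Proof.
move=> cov conn X Y _ _ _ _ [[x [Wx Xx]] [y [Wy Yy]] sub].
move: Wx Wy; rewrite -{1 2}cov => -[W1 SW1 W1x] [W2 SW2 W2y].
have [||||A [FA _] ev] := @chain_evidence (Sigma F W) W1 W2 X Y.
- by move=> A [_ AW]; exact: subset_trans AW sub.
- exact: conn.
- by exists x.
- by exists y.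
- by exists A.
Qed.

End Families.

Theorem mainTheorem5 (Atom : countType) (Agent Var : Type) (VV : set Var)
    (VV_countable : countable VV) (M : depModel Atom Agent VV) (s : M)
    (P : M -> set (set Var)) (P_def : P = @Pg _ _ _ _ M \/ P = @Pl _ _ _ _ M)
    (W : set Var) (W_sub : W `<=` VV) (W_fin : finite_set W)
    (W_neq0 : W !=set0) :
  let Sig := Sigma (P s) W in
  let covers := \bigcup_(W' in Sig) W' = W in
  [<-> generative VV (P s) W;
       covers /\
         forall Z : set Var, Z !=set0 -> Z `<` W ->
           exists2 W', Sig W' & W' `&` Z !=set0 /\ W' `&` (W `\` Z) !=set0;
       covers /\
         forall Gam : set (set Var), Gam !=set0 -> Gam `<` Sig ->
           (\bigcup_(W' in Gam) W') `&` (\bigcup_(W' in Sig `\` Gam) W') !=set0;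
       covers /\
         forall W1 W2 : set Var, Sig W1 -> Sig W2 -> chain_connected Sig W1 W2].
Proof.
move=> Sig covers.
have Sig_neq0 W' : Sig W' -> W' !=set0.
  by case: P_def => PE [+ _]; rewrite PE; [exact: Pg_neq0 | exact: Pl_neq0].
tfae.
- move=> gen; split; first exact: generative_covers W_sub W_fin gen.
  exact: generative_splits W_sub W_fin gen.
- by move=> [cov spl]; split=> //; exact: splits_indecomposable Sig_neq0 cov spl.
- by move=> [cov ind]; split=> // W1 W2; exact: indecomposable_connected.
- by move=> [cov conn]; exact: connected_generative cov conn.
Qed.
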